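(* Let $n\ge 3$ and let $R$ be a ring with $(n-1)$-term Euclidean algorithm. Let $\sigma\in \mathrm{GL}_n(R)$, let $i,j,k,l\in\{1,\dots,n\}$ with $i\neq j$ and $k\neq l$, and let $a,b,c\in R$. Then (i) $t_{kl}(a\sigma_{ij}b)$ is a product of $8(n-1)$ $\mathrm{E}_n(R)$-conjugates of $\sigma$ and $\sigma^{-1}$, and (ii) $t_{kl}(a(c\sigma_{ii}-\sigma_{jj}c)b)$ is a product of $24(n-1)$ $\mathrm{E}_n(R)$-conjugates of $\sigma$ and $\sigma^{-1}$.
   Context: Rings are associative with $1\neq 0$, not necessarily commutative. $R$ is a ring with $m$-term Euclidean algorithm if for any row vector $v$ of length $m$ over $R$ there is a $\tau\in \mathrm{E}_m(R)$ such that $v\tau$ has a zero entry. $\mathrm{GL}_n(R)$ is the group of invertible $n\times n$ matrices over $R$; $\sigma_{ij}$ is the $(i,j)$ entry of $\sigma$. For $i\ne j$ and $x\in R$, $t_{ij}(x)=e+xe^{ij}$, where $e$ is the identity matrix and $e^{ij}$ is the matrix with $1$ at position $(i,j)$ and $0$ elsewhere. For any size $m$, $\mathrm{E}_m(R)$ is the subgroup of $\mathrm{GL}_m(R)$ generated by all $t_{ij}(x)$ ($i\neq j$, $x\in R$). For $g,h$ in a group, $g^h=h^{-1}gh$. ''A product of $N$ $\mathrm{E}_n(R)$-conjugates of $\sigma$ and $\sigma^{-1}$'' means a product of $N$ factors, each of the form $\sigma^{\xi}$ or $(\sigma^{-1})^{\xi}$ with $\xi\in \mathrm{E}_n(R)$.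 *)

(* Defs.v *)
From HB Require Import structures.
From mathcomp Require Import all_boot all_algebra.
Set Implicit Arguments.
Unset Strict Implicit.
Unset Printing Implicit Defensive.

Import GRing.Theory.
Local Open Scope ring_scope.

(* [unitmx] is only available over commutative rings, so an element of GL_n(R)
   is encoded as a matrix packed with its (unique) two-sided inverse. *)
Definition inverse_pair (R : nzRingType) (n : nat) (p : 'M[R]_n * 'M[R]_n) :=
  (p.1 *m p.2 == 1%:M) && (p.2 *m p.1 == 1%:M).

Record GL (R : nzRingType) (n : nat) :=
  MkGL { glpair : 'M[R]_n * 'M[R]_n; _ : inverse_pair glpair }.

HB.instance Definition _ (R : nzRingType) (n : nat) :=
  [isSub for @glpair R n].
HB.instance Definition _ (R : nzRingType) (n : nat) :=
  [Choice of GL R n by <:].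

Definition glval (R : nzRingType) (n : nat) (g : GL R n) : 'M[R]_n :=
  (glpair g).1.
Coercion glval : GL >-> matrix.

Fact gl1_subproof (R : nzRingType) (n : nat) :
  inverse_pair (1%:M : 'M[R]_n, 1%:M : 'M[R]_n).
Proof. by rewrite /inverse_pair /= mulmx1 eqxx. Qed.

Fact glM_subproof (R : nzRingType) (n : nat) (g h : GL R n) :
  inverse_pair ((glpair g).1 *m (glpair h).1, (glpair h).2 *m (glpair g).2).
Proof.
case: g h => -[a a'] pa -[[b b'] pb] /=.
case/andP: pa => /= /eqP aa' /eqP a'a; case/andP: pb => /= /eqP bb' /eqP b'b.
rewrite /inverse_pair /= mulmxA -(mulmxA a) bb' mulmx1 aa' eqxx /=.
by rewrite mulmxA -(mulmxA b') a'a mulmx1 b'b.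
Qed.

Fact glV_subproof (R : nzRingType) (n : nat) (g : GL R n) :
  inverse_pair ((glpair g).2, (glpair g).1).
Proof. by case: g => -[a a'] pa /=; case/andP: pa => aa' a'a; apply/andP; split. Qed.

Definition gl_one (R : nzRingType) (n : nat) : GL R n :=
  MkGL (gl1_subproof R n).
Definition gl_mul (R : nzRingType) (n : nat) (g h : GL R n) : GL R n :=
  MkGL (glM_subproof g h).
Definition gl_inv (R : nzRingType) (n : nat) (g : GL R n) : GL R n :=
  MkGL (glV_subproof g).

Fact gl_mulA (R : nzRingType) (n : nat) : associative (@gl_mul R n).
Proof. by move=> g h k; apply: val_inj; rewrite /= !mulmxA. Qed.

Fact gl_mul1 (R : nzRingType) (n : nat) :
  left_id (gl_one R n) (@gl_mul R n).
Proof.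
by move=> g; apply: val_inj; case: g => -[a a'] ? /=; rewrite mul1mx mulmx1.
Qed.

Fact gl_mulr1 (R : nzRingType) (n : nat) :
  right_id (gl_one R n) (@gl_mul R n).
Proof.
by move=> g; apply: val_inj; case: g => -[a a'] ? /=; rewrite mul1mx mulmx1.
Qed.

Fact gl_mulV (R : nzRingType) (n : nat) :
  left_inverse (gl_one R n) (@gl_inv R n) (@gl_mul R n).
Proof.
move=> g; apply: val_inj; case: g => -[a a'] pa /=.
by case/andP: pa => _ /eqP /= ->.
Qed.

Fact gl_mulrV (R : nzRingType) (n : nat) :
  right_inverse (gl_one R n) (@gl_inv R n) (@gl_mul R n).
Proof.
move=> g; apply: val_inj; case: g => -[a a'] pa /=.
by case/andP: pa => /eqP /= -> _.
Qed.

HB.instance Definition _ (R : nzRingType) (n : nat) :=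
  isGroup.Build (GL R n) (@gl_mulA R n) (@gl_mul1 R n) (@gl_mulr1 R n)
    (@gl_mulV R n) (@gl_mulrV R n).

Lemma glval1 (R : nzRingType) (n : nat) : (1%g : GL R n) = 1%:M :> 'M[R]_n.
Proof. by []. Qed.

Lemma glvalM (R : nzRingType) (n : nat) (g h : GL R n) :
  (g * h)%g = g *m h :> 'M[R]_n.
Proof. by []. Qed.

Lemma glval_inj (R : nzRingType) (n : nat) : injective (@glval R n).
Proof.
move=> g h gh; apply: val_inj; case: g h gh => -[a a'] pa [[b b'] pb].
rewrite /glval /= => ab; subst b; congr (_, _).
case/andP: pa => _ /eqP /= a'a; case/andP: pb => /eqP /= ab' _.
by rewrite -[a']mulmx1 -ab' mulmxA a'a mul1mx.
Qed.

Definition tmx (R : nzRingType) (n : nat) (i j : 'I_n) (x : R) : 'M[R]_n :=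
  1%:M + x *: delta_mx i j.

Fact tmx_subproof (R : nzRingType) (n : nat) (i j : 'I_n) (x : R) :
  i != j -> inverse_pair (tmx i j x, tmx i j (- x)).
Proof.
move=> neq_ij.
have tmxV (y : R) : tmx i j y *m tmx i j (- y) = 1%:M.
  have d0 : (y *: delta_mx i j) *m (- y *: delta_mx i j) = 0 :> 'M[R]_n.
    apply/matrixP=> p q; rewrite !mxE big1 // => r _; rewrite !mxE.
    case: (r =P j) => [->|_]; last by rewrite andbF mulr0 mul0r.
    by rewrite [j == i]eq_sym (negPf neq_ij) /= !mulr0.
  by rewrite /tmx mulmxDl mul1mx mulmxDr mulmx1 d0 addr0 scaleNr subrK.
apply/andP; split; apply/eqP; first exact: tmxV.
by have := tmxV (- x); rewrite opprK.
Qed.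

Definition transv (R : nzRingType) (n : nat) (i j : 'I_n) (neq_ij : i != j)
    (x : R) : GL R n :=
  MkGL (tmx_subproof x neq_ij).

Inductive E (R : nzRingType) (n : nat) : GL R n -> Prop :=
| E_transv (i j : 'I_n) (neq_ij : i != j) (x : R) : E (transv neq_ij x)
| E_one : E 1%g
| E_mul (g h : GL R n) : E g -> E h -> E (g * h)%g
| E_inv (g : GL R n) : E g -> E (g^-1)%g.

Definition euclidean_algorithm (R : nzRingType) (m : nat) : Prop :=
  forall v : 'rV[R]_m,
    exists2 tau : GL R m, E tau & exists j : 'I_m, (v *m tau) 0 j = 0.

Definition E_conjugate (R : nzRingType) (n : nat) (s g : GL R n) : Prop :=
  exists2 xi : GL R n, E xi & (g = s ^ xi)%g \/ (g = s^-1 ^ xi)%g.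

Definition prod_E_conjugates (R : nzRingType) (n : nat) (N : nat)
    (s g : GL R n) : Prop :=
  exists2 f : 'I_N -> GL R n,
    forall p, E_conjugate s (f p) & g = (\prod_(p < N) f p)%g.

(* Main.v *)
Require Import Defs.
From mathcomp Require Import all_boot all_algebra.
Set Implicit Arguments.
Unset Strict Implicit.
Unset Printing Implicit Defensive.
Import GRing.Theory.
Local Open Scope ring_scope.

(** Suppose first that s_ij = 0 for some j <> i, and let T = 1 + e_j (row i of
    s). It is a product of the transvections t_jm(s_im), and since the row
    vector e_i^T s s^-1 is e_i^T, its conjugate A = s T s^-1 equals
    1 + (column j of s) e_i^T. Both T and A are transvections exactly because
    s_ij = 0. Now A commutes with every t = t_ri(z), because both change column
    i only, so that the commutator of [~ s^-1, T] = A^-1 T with t does not see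
    A and is [~ T, t] = t_ji(s_ir z). Two nested commutators starting from s^-1
    cost 2 * 2 = 4 conjugates ([prod_E_conjugates_adjacent]); a third one with
    t_qj(a) multiplies by a on the left and brings the cost to 8. Transvections
    in different positions are E_n-conjugate because n >= 3, so the position
    reached does not matter ([prod_E_conjugates_vanishing]).

    In general, the Euclidean algorithm applied to the n - 1 off-diagonal
    entries of row i gives tau in E_(n-1); conjugating sigma by tau, embedded as
    a block that omits the index i, multiplies this vector by tau and creates
    the required zero. As sigma_ij is a right linear combination, with
    coefficients from tau^-1, of the n - 1 new entries, additivity of t_kl gives
    8 (n - 1) conjugates, which is (i).

    For (ii), let s be t_ji(c) sigma t_ji(-c). Then
      c sigma_ii - sigma_jj c = s_ji - sigma_ji + c sigma_ij c,
    and (i) applies to each of the three off-diagonal entries on the right. *)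

(** * Products of elementary conjugates *)

Section ConjugateProducts.

Variables (R : nzRingType) (n : nat).
Implicit Types (s g h : GL R n).

Lemma E_conjugateJ s g h : E h -> E_conjugate s g -> E_conjugate s (g ^ h)%g.
Proof.
move=> Eh [xi Exi eg]; exists (xi * h)%g; first exact: E_mul.
by rewrite !conjgM; case: eg => ->; [left | right].
Qed.

Lemma E_conjugateV s g : E_conjugate s g -> E_conjugate s (g^-1)%g.
Proof.
move=> [xi Exi eg]; exists xi => //.
by case: eg => ->; [right | left]; rewrite -conjVg ?invgK.
Qed.

Lemma prod_E_conjugates_conjugate s g :
  E_conjugate s g -> prod_E_conjugates 1 s g.
Proof. by move=> sg; exists (fun=> g) => //; rewrite big_ord1. Qed.

Lemma prod_E_conjugatesM N1 N2 s g h :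
    prod_E_conjugates N1 s g -> prod_E_conjugates N2 s h ->
  prod_E_conjugates (N1 + N2) s (g * h)%g.
Proof.
move=> [f1 sf1 ->] [f2 sf2 ->].
exists (fun p => match split p with inl p1 => f1 p1 | inr p2 => f2 p2 end).
  by move=> p; case: (split p).
rewrite big_split_ord; congr (_ * _)%g; apply: eq_bigr => p _.
  by rewrite (unsplitK (inl _ p)).
by rewrite (unsplitK (inr _ p)).
Qed.

Lemma prod_E_conjugates_prod N m s (F : 'I_m -> GL R n) :
    (forall p, prod_E_conjugates N s (F p)) ->
  prod_E_conjugates (N * m) s (\prod_(p < m) F p)%g.
Proof.
elim: m F => [|m IHm] F sF.
  by rewrite muln0 big_ord0; exists (fun=> 1%g); [case | rewrite big_ord0].
by rewrite mulnS big_ord_recl; apply: prod_E_conjugatesM => //; apply: IHm.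
Qed.

Lemma prod_E_conjugatesJ N s g h :
  E h -> prod_E_conjugates N s g -> prod_E_conjugates N s (g ^ h)%g.
Proof.
move=> Eh [f sf ->]; exists (fun p => f p ^ h)%g => [p|].
  exact: E_conjugateJ.
by elim/big_rec2: _ => [|p x y _ <-]; rewrite ?conj1g ?conjMg.
Qed.

Lemma prod_E_conjugatesV N s g :
  prod_E_conjugates N s g -> prod_E_conjugates N s (g^-1)%g.
Proof.
move=> [f sf ->] {g}; elim: N f sf => [|N IHN] f sf.
  by rewrite big_ord0 invg1; exists f; rewrite ?big_ord0.
rewrite big_ord_recl invgM -[X in prod_E_conjugates X]addn1.
apply: prod_E_conjugatesM; first exact: IHN.
by apply/prod_E_conjugates_conjugate/E_conjugateV.
Qed.

(** Commutation with an elementary matrix doubles the number of factors, since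
    [~ g, h] is g^-1 times an elementary conjugate of g. *)
Lemma prod_E_conjugatesR N s g h :
    E h -> prod_E_conjugates N s g ->
  prod_E_conjugates (2 * N) s [~ g, h]%g.
Proof.
move=> Eh sg; rewrite mul2n -addnn; apply: prod_E_conjugatesM.
  exact: prod_E_conjugatesV.
exact: prod_E_conjugatesJ.
Qed.

Lemma prod_E_conjugates_base N s g h :
  E h -> prod_E_conjugates N (s ^ h)%g g -> prod_E_conjugates N s g.
Proof.
move=> Eh [f sf ->]; exists f => // p; have [xi Exi fp] := sf p.
exists (h * xi)%g; first exact: E_mul.
by rewrite !conjgM conjVg.
Qed.

End ConjugateProducts.

(** * Relations between transvections *)

Section Transvections.

Variables (R : nzRingType) (n : nat).
Implicit Types (x y : R) (i j k l : 'I_n) (s : GL R n).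

Lemma mul_scale_delta_mx (m p q : nat) (i : 'I_m) (j k : 'I_p) (l : 'I_q) x y :
  (x *: delta_mx i j) *m (y *: delta_mx k l)
    = (x * y *+ (j == k)) *: delta_mx i l.
Proof.
apply/matrixP => a b; rewrite !mxE (bigD1 j) //= !mxE eqxx big1 ?addr0.
  case: (a == i); case: (b == l); case: (j == k);
  by rewrite /= ?mulr1 ?mulr0 ?mul0r ?mulr0n.
by move=> r /negPf rj; rewrite !mxE rj andbF mulr0 mul0r.
Qed.

Lemma glval_transv i j (ij : i != j) x :
  transv ij x = 1%:M + x *: delta_mx i j :> 'M[R]_n.
Proof. by []. Qed.

Lemma transv0 i j (ij : i != j) : transv ij (0 : R) = 1%g.
Proof. by apply: glval_inj; rewrite glval_transv scale0r addr0. Qed.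

Lemma transvD i j (ij : i != j) x y :
  transv ij (x + y) = (transv ij x * transv ij y)%g.
Proof.
apply: glval_inj; rewrite glvalM !glval_transv mulmxDl mul1mx mulmxDr mulmx1.
by rewrite mul_scale_delta_mx eq_sym (negPf ij) mulr0n scale0r addr0 addrAC
  scalerDl addrA addrAC.
Qed.

Lemma transv_sum i j (ij : i != j) m (F : 'I_m -> R) :
  transv ij (\sum_(p < m) F p) = (\prod_(p < m) transv ij (F p))%g.
Proof.
elim: m F => [|m IHm] F; first by rewrite !big_ord0 transv0.
by rewrite !big_ord_recl transvD IHm.
Qed.

Lemma transvV i j (ij : i != j) x : (transv ij x)^-1%g = transv ij (- x).
Proof.
by apply: (mulgI (transv ij x)); rewrite mulgV -transvD subrr transv0.
Qed.

Lemma transvC i j k l (ij : i != j) (kl : k != l) x y :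
  j != k -> i != l -> (transv ij x ^ transv kl y = transv ij x)%g.
Proof.
move=> jk il; apply: (mulgI (transv kl y)); rewrite -conjgC; apply: glval_inj.
rewrite !glvalM !glval_transv !(mulmxDl, mulmxDr, mulmx1, mul1mx).
rewrite !mul_scale_delta_mx (negPf jk) [l == i]eq_sym (negPf il).
by rewrite !mulr0n !scale0r !addr0 addrAC.
Qed.

Lemma transvJr i j k (ij : i != j) (jk : j != k) (ik : i != k) x y :
  (transv ij x ^ transv jk y = transv ij x * transv ik (x * y))%g.
Proof.
apply: (mulgI (transv jk y)); rewrite -conjgC; apply: glval_inj.
rewrite !glvalM !glval_transv.
rewrite !(mulmxDl, mulmxDr, mulmx1, mul1mx, mul_scale_delta_mx).
rewrite eqxx ![k == i]eq_sym ![j == i]eq_sym (negPf ij) (negPf ik).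
rewrite !mulr0n mulr1n !scale0r !(mulmx0, addr0, add0r) -!addrA.
by congr (_ + _); rewrite addrC (addrC (x *: _)) -addrA.
Qed.

Lemma transvR i j k (ij : i != j) (jk : j != k) (ik : i != k) x y :
  [~ transv ij x, transv jk y]%g = transv ik (x * y).
Proof. by rewrite commgEl transvJr mulKg. Qed.

Lemma transvJl i j k (ij : i != j) (ki : k != i) (kj : k != j) x y :
  (transv ij x ^ transv ki y = transv ij x * transv kj (- (y * x)))%g.
Proof.
apply: (mulgI (transv ij x)^-1%g).
by rewrite mulKg -commgEl -invgR transvR transvV.
Qed.

(** Conjugation by t_lm(1) t_ml(-1), which acts like a Weyl element without
    introducing a sign, changes the column of a transvection. *)
Lemma prod_E_conjugates_transv_col N s k l m (kl : k != l) (km : k != m) x :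
    prod_E_conjugates N s (transv kl x) ->
  prod_E_conjugates N s (transv km x).
Proof.
move=> sx; case: (eqVneq l m) => [lm|lm].
  by move: km; rewrite -lm => km; rewrite (bool_irrelevance km kl).
have ml : m != l by rewrite eq_sym.
have := prod_E_conjugatesJ (E_transv ml (-1))
          (prod_E_conjugatesJ (E_transv lm 1) sx).
rewrite transvJr conjMg transvC // 1?eq_sym // mulr1 transvJr // mulrN1.
by rewrite -{1}[x]opprK -(transvV kl (- x)) -conjgE transvC // eq_sym.
Qed.

Lemma prod_E_conjugates_transv_row N s k l m (kl : k != l) (ml : m != l) x :
    prod_E_conjugates N s (transv kl x) ->
  prod_E_conjugates N s (transv ml x).
Proof.
move=> sx; case: (eqVneq k m) => [km|km].
  by move: ml; rewrite -km => ml; rewrite (bool_irrelevance ml kl).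
have mk : m != k by rewrite eq_sym.
have := prod_E_conjugatesJ (E_transv km 1)
          (prod_E_conjugatesJ (E_transv mk (-1)) sx).
rewrite transvJl conjMg transvC // 1?eq_sym // mulN1r opprK transvJl mul1r.
by rewrite -{1}[x]opprK -(transvV kl (- x)) -conjgE transvC // eq_sym.
Qed.

Lemma exists_ord_neq2 k l : (3 <= n)%N -> exists r : 'I_n, (r != k) && (r != l).
Proof.
move=> n3; have /card_gt0P[r] : (0 < #|~: [set k; l]|)%N.
  have := cardsC [set k; l]; rewrite card_ord cards2 => e.
  rewrite -(ltn_add2l (k != l).+1) e addn0 (leq_ltn_trans _ n3) //.
  by case: (k != l).
by rewrite !inE negb_or; exists r.
Qed.

(** All root subgroups are E_n-conjugate when n is at least 3, so it is enough
    to produce a transvection in a convenient position. *)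
Lemma prod_E_conjugates_transv N s k l k' l' (kl : k != l) (kl' : k' != l') x :
    (3 <= n)%N -> prod_E_conjugates N s (transv kl x) ->
  prod_E_conjugates N s (transv kl' x).
Proof.
move=> n3; have [r /andP[rk rk']] := exists_ord_neq2 k k' n3.
have kr : k != r by rewrite eq_sym.
have kr' : k' != r by rewrite eq_sym.
by move=> /(prod_E_conjugates_transv_col kr)
  /(prod_E_conjugates_transv_row kr') /(prod_E_conjugates_transv_col kl').
Qed.

End Transvections.

(** * A matrix with a vanishing off-diagonal entry *)

Section VanishingEntry.

Variables (R : nzRingType) (n : nat).
Implicit Types (s : GL R n) (i j k l : 'I_n).

Lemma mul_delta_mx_scale (m p q : nat) (i : 'I_m) (j k : 'I_p) (l : 'I_q)
    (x : R) :
  delta_mx i j *m (x *: delta_mx k l) = (x *+ (j == k)) *: delta_mx i l.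
Proof. by rewrite -[delta_mx i j]scale1r mul_scale_delta_mx mul1r. Qed.

Lemma mul_row_scale_delta (v : 'rV[R]_n) i j x :
  v *m (x *: delta_mx i j) = (v 0 i * x) *: delta_mx 0 j.
Proof.
apply/rowP => b; rewrite !mxE (bigD1 i) //= !mxE eqxx big1 ?addr0 ?mulrA //.
by move=> r /negPf ri; rewrite !mxE ri mulr0 mulr0.
Qed.

(** The condition v_j = 0 makes T the product of the t_jm(v_m), m <> j. *)
Lemma exists_E_row_transvection j (v : 'rV[R]_n) :
    v 0 j = 0 ->
  exists2 T : GL R n, E T & T = 1%:M + delta_mx j 0 *m v :> 'M[R]_n.
Proof.
move=> vj; rewrite [v]row_sum_delta.
elim/big_rec: _ => [|m w _ [T ET Tw]].
  by exists 1%g; [exact: E_one | rewrite mulmx0 addr0].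
have [mj|jm] := eqVneq j m.
  by exists T; rewrite // -mj vj scale0r add0r.
exists (transv jm (v 0 m) * T)%g.
  by apply: E_mul => //; apply: E_transv.
rewrite glvalM glval_transv Tw !(mulmxDl, mulmxDr, mulmx1, mul1mx).
rewrite mulmxA -scalemxAl mul_delta_mx_0 1?eq_sym // scaler0 mul0mx addr0.
by rewrite mul_delta_mx_scale eqxx -addrA [_ *m w + _]addrC.
Qed.

Lemma row_transvectionR i j r (ri : r != i) (ji : j != i) (T : GL R n)
    (v : 'rV[R]_n) z :
    v 0 j = 0 -> T = 1%:M + delta_mx j 0 *m v :> 'M[R]_n ->
  [~ T, transv ri z]%g = transv ji (v 0 r * z).
Proof.
move=> vj Tv.
apply: (mulgI T); rewrite commgEl mulVKg; apply: (mulgI (transv ri z)).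
rewrite -conjgC; apply: glval_inj; rewrite !glvalM Tv !glval_transv.
rewrite !(mulmxDl, mulmxDr, mulmx1, mul1mx, mul_scale_delta_mx).
rewrite [i == j]eq_sym (negPf ji) mulr0n scale0r addr0 mulmxA -scalemxAl.
rewrite mul_delta_mx_0 1?eq_sym // scaler0 mul0mx add0r.
rewrite -!mulmxA !mul_row_scale_delta vj mul0r scale0r !mulmx0 !addr0.
rewrite mul_delta_mx_scale eqxx mulr1n -!addrA; congr (_ + _).
by rewrite addrC [_ *m v + _]addrC -addrA.
Qed.

(** With T = 1 + e_j (row i of s), the conjugate s T s^-1 = 1 + (column j of s)
    e_i^T is a column transvection and therefore commutes with t_ri(z). *)
Lemma row_transvection_conj_comm s i j r (ri : r != i) (T : GL R n) z :
    s i j = 0 -> T = 1%:M + delta_mx j 0 *m row i s :> 'M[R]_n ->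
  commute (T ^ s^-1)%g (transv ri z).
Proof.
move=> sij Ts.
have TsE : (T ^ s^-1)%g = 1%:M + col j s *m delta_mx 0 i :> 'M[R]_n.
  rewrite /conjg invgK !glvalM Ts mulmxDl mul1mx mulmxDr -!glvalM mulgV glval1.
  by rewrite mulmxA mulmxA -colE -mulmxA -row_mul -glvalM mulgV glval1 row1.
rewrite /commute; move: (T ^ s^-1)%g TsE => A AE.
apply: glval_inj; rewrite !glvalM AE !glval_transv.
rewrite !(mulmxDl, mulmxDr, mulmx1, mul1mx) -mulmxA mul_delta_mx_scale.
rewrite eq_sym (negPf ri) mulr0n scale0r mulmx0 addr0 mulmxA -scalemxAl.
rewrite (_ : delta_mx r i *m col j s = 0) ?scaler0 ?mul0mx ?addr0 1?addrAC //.
by rewrite -(mul_delta_mx (0 : 'I_1)) -mulmxA -rowE [row _ _]mx11_scalar !mxE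
  sij raddf0 mulmx0.
Qed.

(** Write A = T^(s^-1) for the row transvection T built from row i of s. Since
    [~ s^-1, T] = A^-1 T and A commutes with t = t_ri(z), the double commutator
    [~ [~ s^-1, T], t] collapses to [~ T, t] = t_ji(s_ir z). *)
Lemma prod_E_conjugates_adjacent s i j r (ri : r != i) (ji : j != i) z :
    s i j = 0 -> prod_E_conjugates 4 s (transv ji (s i r * z)).
Proof.
move=> sij; have [|T ET Ts] := @exists_E_row_transvection j (row i s).
  by rewrite mxE.
have <- : [~ [~ s^-1, T], transv ri z]%g = transv ji (s i r * z).
  have -> : s i r = row i s 0 r by rewrite mxE.
  rewrite -(row_transvectionR ri ji z _ Ts) ?mxE //.
  have cA := row_transvection_conj_comm ri z sij Ts.
  have -> : [~ s^-1, T]%g = ((T ^ s^-1)^-1 * T)%g by rewrite commgEr conjVg.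
  move: (T ^ s^-1)%g cA => A cA.
  have At : (A ^ transv ri z = A)%g by rewrite /conjg cA mulKg.
  by rewrite !commgEl conjMg conjVg At invgM invgK mulgA mulgK.
apply: (@prod_E_conjugatesR _ _ 2); first exact: E_transv.
apply: (@prod_E_conjugatesR _ _ 1) => //.
apply: prod_E_conjugates_conjugate; exists 1%g; first exact: E_one.
by right; rewrite conjg1.
Qed.

(** The factor z of the previous lemma already provides b; the factor a comes
    from the commutator with t_qj(a), which needs a third index q. *)
Lemma prod_E_conjugates_vanishing s i j r k l
    (ij : i != j) (ir : i != r) (kl : k != l) a b :
    (3 <= n)%N -> s i j = 0 ->
  prod_E_conjugates 8 s (transv kl (a * s i r * b)).
Proof.
move=> n3 sij; have ji : j != i by rewrite eq_sym.
have ri : r != i by rewrite eq_sym.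
have [q /andP[qi qj]] := exists_ord_neq2 i j n3.
apply: (prod_E_conjugates_transv (kl := qi)) => //.
rewrite -mulrA -(transvR qj ji) -invgR; apply: prod_E_conjugatesV.
apply: (@prod_E_conjugatesR _ _ 4); first exact: E_transv.
exact: prod_E_conjugates_adjacent ri ji b sij.
Qed.

End VanishingEntry.

(** * Block embedding of E_m into E_(m+1) *)

Section Embedding.

Variables (R : nzRingType) (m : nat) (i : 'I_m.+1).

Local Notation skip_rows := (rowsub (lift i)).
Local Notation skip_cols := (colsub (lift i)).

(** The block sum of 1, in position i, and of A, in the remaining rows and
    columns, written as a sum of matrix products so that multiplicativity is
    pure algebra. *)
Definition block_mx1 (A : 'M[R]_m) : 'M[R]_m.+1 :=
  delta_mx i i + skip_cols 1%:M *m A *m skip_rows 1%:M.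

Lemma mul_skip_rows_cols : skip_rows 1%:M *m skip_cols 1%:M = 1%:M :> 'M[R]_m.
Proof.
rewrite -rowsubE; apply/matrixP=> p q.
by rewrite !mxE (inj_eq lift_inj).
Qed.

Lemma mul_skip_rows_delta (q : 'I_m.+1) :
  skip_rows 1%:M *m delta_mx i q = 0 :> 'M[R]_(m, m.+1).
Proof.
rewrite -rowsubE; apply/matrixP=> p r.
by rewrite !mxE eq_sym (negPf (neq_lift _ _)).
Qed.

Lemma mul_delta_skip_cols (p : nat) (q : 'I_p) :
  delta_mx q i *m skip_cols 1%:M = 0 :> 'M[R]_(p, m).
Proof.
rewrite mulmx_colsub mulmx1; apply/matrixP=> r t.
by rewrite !mxE [_ == i]eq_sym (negPf (neq_lift _ _)) andbF.
Qed.

Lemma block_mx1_one : block_mx1 1%:M = 1%:M.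
Proof.
rewrite /block_mx1 mulmx1; apply/matrixP=> p q; rewrite !mxE.
case: (unliftP i p) => [r|] ->; last first.
  rewrite eqxx big1 ?addr0 // => [|r _]; last first.
    by rewrite !mxE (negPf (neq_lift _ _)) mul0r.
  by rewrite eq_sym.
rewrite [_ == i]eq_sym (negPf (neq_lift _ _)) add0r (bigD1 r) //=.
rewrite !mxE eqxx mul1r.
rewrite big1 ?addr0 // => t tr.
by rewrite !mxE (inj_eq lift_inj) eq_sym (negPf tr) mul0r.
Qed.

Lemma block_mx1M A B : block_mx1 (A *m B) = block_mx1 A *m block_mx1 B.
Proof.
rewrite /block_mx1 !(mulmxDl, mulmxDr) mul_delta_mx -!mulmxA.
rewrite mul_skip_rows_delta !mulmx0 (mulmxA (delta_mx i i)) mul_delta_skip_cols.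
by rewrite mul0mx addr0 add0r (mulmxA (skip_rows _)) mul_skip_rows_cols mul1mx.
Qed.

Lemma block_mx1_tmx (p q : 'I_m) x :
  block_mx1 (tmx p q x) = tmx (lift i p) (lift i q) x.
Proof.
rewrite /tmx -[X in _ = X + _]block_mx1_one /block_mx1 mulmxDr mulmxDl addrA.
congr (_ + _).
have -> : skip_cols 1%:M *m (x *: delta_mx p q)
            = x *: delta_mx (lift i p) q :> 'M[R]_(m.+1, m).
  apply/matrixP=> r t; rewrite !mxE (bigD1 p) //= !mxE eqxx big1 ?addr0.
    by case: (r == _); rewrite ?mul1r // mul0r mulr0.
  by move=> u /negPf up; rewrite !mxE up !mulr0.
rewrite -scalemxAl; congr (_ *: _); apply/matrixP=> r t.
rewrite !mxE (bigD1 q) //= !mxE eqxx andbT big1 ?addr0.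
  by rewrite -natrM mulnb [t == _]eq_sym.
by move=> u /negPf uq; rewrite !mxE uq andbF mul0r.
Qed.

Fact block_GL_subproof (g : GL R m) :
  inverse_pair (block_mx1 (glpair g).1, block_mx1 (glpair g).2).
Proof.
case: g => -[a a'] /= /andP[/eqP /= aa' /eqP /= a'a].
by rewrite /inverse_pair /= -!block_mx1M aa' a'a block_mx1_one eqxx.
Qed.

Definition block_GL (g : GL R m) : GL R m.+1 := MkGL (block_GL_subproof g).

Lemma E_block_GL g : E g -> E (block_GL g).
Proof.
elim=> {g} [p q pq x||g h _ Eg _ Eh|g _ Eg].
- have pq' : lift i p != lift i q by rewrite (inj_eq lift_inj).
  have -> : block_GL (transv pq x) = transv pq' x.
    by apply: glval_inj; apply: block_mx1_tmx.
  exact: E_transv.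
- have -> : block_GL 1%g = 1%g by apply: glval_inj; apply: block_mx1_one.
  exact: E_one.
- have -> : block_GL (g * h)%g = (block_GL g * block_GL h)%g.
    by apply: glval_inj; apply: block_mx1M.
  exact: E_mul.
- have -> : block_GL (g^-1)%g = (block_GL g)^-1%g by apply: val_inj.
  exact: E_inv.
Qed.

(** Row i of a block matrix is e_i^T, so conjugation affects row i of s through
    the right factor only, and that factor acts as g outside column i. *)
Lemma row_conj_block_GL (s : GL R m.+1) (g : GL R m) :
  skip_cols (row i (s ^ block_GL g)%g) = skip_cols (row i s) *m g.
Proof.
have row_block (h : GL R m) : row i (block_GL h) = delta_mx 0 i.
  rewrite rowE /glval /= /block_mx1 mulmxDr mul_delta_mx !mulmxA.
  by rewrite mul_delta_skip_cols !mul0mx addr0.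
have -> : row i (s ^ block_GL g)%g = row i s *m block_GL g.
  rewrite /conjg !glvalM row_mul (_ : (block_GL g)^-1%g = block_GL (g^-1)%g).
    by rewrite row_block mulmxA -rowE.
  exact: val_inj.
have block_cols : block_GL g *m skip_cols 1%:M = skip_cols 1%:M *m g.
  rewrite {1}/glval /= /block_mx1 mulmxDl mul_delta_skip_cols add0r.
  by rewrite -mulmxA mul_skip_rows_cols mulmx1.
rewrite -[X in skip_cols X]mulmx1 -mulmx_colsub -mulmxA block_cols mulmxA.
by rewrite mulmx_colsub mulmx1.
Qed.

End Embedding.

(** * The general case *)

Lemma prod_E_conjugates_offdiag (R : nzRingType) (n : nat) (hn : (3 <= n)%N)
    (hR : euclidean_algorithm R (n - 1)) (sigma : GL R n)
    (i j k l : 'I_n) (hij : i != j) (hkl : k != l) (a b : R) :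
  prod_E_conjugates (8 * (n - 1)) sigma (transv hkl (a * sigma i j * b)).
Proof.
case: n => [//|m] in hn hR sigma i j k l hij hkl *.
rewrite subn1 /= in hR *.
have [tau Etau [p0 vp0]] := hR (colsub (lift i) (row i sigma)).
apply: (prod_E_conjugates_base (E_block_GL i Etau)).
rewrite -row_conj_block_GL in vp0.
set s := (sigma ^ _)%g in vp0 *.
have sp0 : s i (lift i p0) = 0 by rewrite -vp0 !mxE.
have [q jq _] := unlift_some hij.
have -> : sigma i j = \sum_(p < m) s i (lift i p) * (tau^-1)%g p q.
  have : colsub (lift i) (row i sigma)
           = colsub (lift i) (row i s) *m (tau^-1)%g.
    by rewrite row_conj_block_GL -mulmxA -glvalM mulgV mulmx1.
  move/rowP/(_ q); rewrite !mxE jq => ->; apply: eq_bigr => p _; rewrite !mxE.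
  by [].
rewrite mulr_sumr mulr_suml transv_sum.
apply: prod_E_conjugates_prod => p; rewrite mulrA -[_ * _ * b]mulrA.
by apply: (prod_E_conjugates_vanishing (j := lift i p0)); rewrite ?neq_lift.
Qed.

Theorem theorem22 (R : nzRingType) (n : nat) (hn : (3 <= n)%N)
    (hR : euclidean_algorithm R (n - 1)) (sigma : GL R n)
    (i j k l : 'I_n) (hij : i != j) (hkl : k != l) (a b c : R) :
  prod_E_conjugates (8 * (n - 1)) sigma
    (transv hkl (a * sigma i j * b))
  /\
  prod_E_conjugates (24 * (n - 1)) sigma
    (transv hkl (a * (c * sigma i i - sigma j j * c) * b)).
Proof.
split; first exact: prod_E_conjugates_offdiag.
have hji : j != i by rewrite eq_sym.
pose s := (sigma ^ transv hji (- c))%g.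
have sji : s j i = sigma j i + c * sigma i i - (sigma j j + c * sigma i j) * c.
  have -> : s = (transv hji c * sigma * transv hji (- c))%g.
    by rewrite /s /conjg transvV opprK mulgA.
  have tE q : (transv hji c * sigma)%g j q = sigma j q + c * sigma i q.
    rewrite glvalM glval_transv mulmxDl mul1mx -scalemxAl !mxE (bigD1 i) //=.
    rewrite !mxE !eqxx mul1r big1 ?addr0 // => r /negPf ri.
    by rewrite !mxE ri andbF mul0r.
  rewrite glvalM glval_transv mulmxDr mulmx1 mxE tE; congr (_ + _).
  rewrite mxE (bigD1 j) //= tE !mxE !eqxx mulr1 mulrN big1 ?addr0 // => r.
  move=> /negPf rj.
  by rewrite !mxE rj !mulr0.
have -> : c * sigma i i - sigma j j * c = s j i - sigma j i + c * sigma i j * c.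
  rewrite sji mulrDl opprD addrAC addrA subrK.
  by rewrite -[X in _ = X - _]addrA [RHS]addrC addKr.
have -> : a * (s j i - sigma j i + c * sigma i j * c) * b
    = a * s j i * b + (- a) * sigma j i * b + (a * c) * sigma i j * (c * b).
  by rewrite !(mulrDr, mulrDl, mulrN, mulNr) !mulrA.
have -> : (24 * (n - 1) = 8 * (n - 1) + 8 * (n - 1) + 8 * (n - 1))%N.
  by rewrite -!mulnDl.
rewrite !transvD.
do 2?[apply: prod_E_conjugatesM]; try exact: prod_E_conjugates_offdiag.
apply: (prod_E_conjugates_base (E_transv hji (- c))).
exact: prod_E_conjugates_offdiag.
Qed.
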